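(* Let $(M,+,0,E)$ be a flow domain and $\mathfrak{N}$ a set of nodes. Let $\mathsf{FI}$ be the set of all flow interfaces over $(M,+,0)$ and $\mathfrak{N}$, let $\oplus$ be flow interface composition, and let $I_\emptyset$ be the interface of the empty flow graph. Then $(\mathsf{FI},\oplus,I_\emptyset)$ is a separation algebra, i.e. $\oplus$ is a partial binary operation on $\mathsf{FI}$ that is associative and commutative (in the sense that for each equation either both sides are undefined or both are defined and equal), $I_\emptyset$ is an identity ($I \oplus I_\emptyset = I_\emptyset \oplus I = I$ for all $I$), and $\oplus$ is cancellative (if $I_1\oplus I_2 = I_1 \oplus I_3$ is defined then $I_2 = I_3$).
   Context: A flow domain $(M,+,0,E)$ consists of a commutative cancellative monoid $(M,+,0)$ ($+$ total, associative, commutative, $0$ an identity, and $m_1+m_2=m_1+m_3$ implies $m_2=m_3$) and a set $E$ of functions $M\to M$ (edge functions). Fix a (possibly infinite) set of nodes $\mathfrak{N}$. A flow interface is a pair $I=(\mathit{in},\mathit{out})$ with $\mathit{in}\colon N\to M$ and $\mathit{out}\colon \mathfrak{N}\setminus N\to M$ for some $N\subseteq\mathfrak{N}$; $N$ is called the domain of $I$ (also written $I$), and we write $\mathit{in}_I,\mathit{out}_I$ for the components. The composition $I_1\oplus I_2$ is defined as follows: if the domains of $I_1,I_2$ are disjoint and there is an interface $I$ with domain $I_1\uplus I_2$ such that (i) for all $i\neq j\in\{1,2\}$ and $n\in I_i$, $\mathit{in}_{I_i}(n)=\mathit{in}_I(n)+\mathit{out}_{I_j}(n)$, and (ii) for all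 $n\notin I$, $\mathit{out}_I(n)=\mathit{out}_{I_1}(n)+\mathit{out}_{I_2}(n)$, then $I_1\oplus I_2:=I$ (such $I$ is unique by cancellativity); otherwise $I_1\oplus I_2$ is undefined. The interface of the empty flow graph is $I_\emptyset=(\epsilon,\lambda n\in\mathfrak{N}.\,0)$, where $\epsilon$ is the function with empty domain. *)

(* Defs.v *)
From HB Require Import structures.
From mathcomp Require Import all_boot all_order all_algebra.
From mathcomp Require Import boolp classical_sets.

Set Implicit Arguments.
Unset Strict Implicit.
Unset Printing Implicit Defensive.

Import GRing.Theory.
Local Open Scope classical_set_scope.
Local Open Scope ring_scope.

(* [nmodType] is the commutative monoids; the choice structure that it carries
   exists on every type in the classical setting of [boolp]. *)
Record flowDomain := FlowDomain {
  fd_monoid :> nmodType;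
  fd_addI : forall m1 m2 m3 : fd_monoid, m1 + m2 = m1 + m3 -> m2 = m3;
  fd_edge : set (fd_monoid -> fd_monoid)
}.

(* A function defined on a set A of nodes is rendered as a function taking a
   node n and a proof of A n; it cannot depend on the proof, by proof
   irrelevance. *)
Record flow_interface (M : flowDomain) (node : Type) := FlowInterface {
  dom : set node;
  inflow : forall n : node, dom n -> M;
  outflow : forall n : node, (~` dom) n -> M
}.

Section Composition.
Variables (M : flowDomain) (node : Type).
Implicit Types I : flow_interface M node.

(* The membership proofs quantified over in the last three fields all follow
   from the first two fields and the membership of n in the stated range. *)
Record is_composition I1 I2 I : Prop := IsComposition {
  comp_disjoint : dom I1 `&` dom I2 = set0;
  comp_dom : dom I = dom I1 `|` dom I2;
  comp_in1 : forall n (n_I1 : dom I1 n) (n_I : dom I n)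
      (nN_I2 : (~` dom I2) n),
    inflow n_I1 = inflow n_I + outflow nN_I2;
  comp_in2 : forall n (n_I2 : dom I2 n) (n_I : dom I n)
      (nN_I1 : (~` dom I1) n),
    inflow n_I2 = inflow n_I + outflow nN_I1;
  comp_out : forall n (nN_I : (~` dom I) n) (nN_I1 : (~` dom I1) n)
      (nN_I2 : (~` dom I2) n),
    outflow nN_I = outflow nN_I1 + outflow nN_I2
}.

Definition interface_comp I1 I2 : option (flow_interface M node) :=
  if pselect (exists I, is_composition I1 I2 I) is left I_ex
  then Some (projT1 (cid I_ex)) else None.

Definition empty_interface : flow_interface M node :=
  @FlowInterface M node set0 (fun n n_0 => False_rect M n_0) (fun _ _ => 0).

Lemma flow_interfaceP I I' : dom I = dom I' ->
  (forall n (h : dom I n) (h' : dom I' n), inflow h = inflow h') ->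
  (forall n (h : (~` dom I) n) (h' : (~` dom I') n), outflow h = outflow h') ->
  I = I'.
Proof.
case: I I' => [A f g] [B f' g'] /= eqAB; subst B => eqf eqg.
by congr FlowInterface; apply: functional_extensionality_dep => n;
  apply: functional_extensionality_dep => h; [apply: eqf|apply: eqg].
Qed.

Lemma is_composition_unique I1 I2 I I' :
  is_composition I1 I2 I -> is_composition I1 I2 I' -> I = I'.
Proof.
case=> disj eqI in1 in2 out [_ eqI' in1' in2' out'].
have disjP n : dom I1 n -> ~ dom I2 n.
  by move=> n1 n2; have : (dom I1 `&` dom I2) n by []; rewrite disj.
apply: flow_interfaceP => [|n h h'|n h h']; first by rewrite eqI eqI'.
- have : (dom I1 `|` dom I2) n by rewrite -eqI.
  case=> [n1|n2].
  + have nN2 : (~` dom I2) n by exact: disjP.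
    apply: (@fd_addI M (outflow nN2)); rewrite addrC -in1 [RHS]addrC.
    exact: in1'.
  + have nN1 : (~` dom I1) n by move=> /disjP.
    apply: (@fd_addI M (outflow nN1)); rewrite addrC -in2 [RHS]addrC.
    exact: in2'.
- have nN1 : (~` dom I1) n by move=> n1; apply: h; rewrite eqI; left.
  have nN2 : (~` dom I2) n by move=> n2; apply: h; rewrite eqI; right.
  by rewrite (out _ h nN1 nN2) (out' _ h' nN1 nN2).
Qed.

Lemma interface_compP I1 I2 I :
  interface_comp I1 I2 = Some I <-> is_composition I1 I2 I.
Proof.
rewrite /interface_comp; case: pselect => [I_ex|I_nex]; split=> //.
- by case=> <-; case: (cid I_ex).
- by move=> I12; congr Some; case: cid => J /= J12; exact: is_composition_unique J12 I12.
- by move=> I12; case: I_nex; exists I.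
Qed.

End Composition.

(* An equation between partial terms holds when both sides are undefined
   ([None]) or both are defined and equal. *)
Record separation_algebra (A : Type) (op : A -> A -> option A) (e : A) : Prop :=
  SeparationAlgebra {
    sep_assoc : forall x y z,
      obind (fun xy => op xy z) (op x y) = obind (fun yz => op x yz) (op y z);
    sep_comm : forall x y, op x y = op y x;
    sep_id : forall x, op x e = Some x /\ op e x = Some x;
    sep_cancel : forall x y z, isSome (op x y) -> op x y = op x z -> y = z
  }.

(* Main.v *)
(** Composition is checked node by node. The only interface to be invented is
    [I2 (+) I3], given [I1 (+) I2 = I12] and [I12 (+) I3 = I]: at a node of
    [I2] or [I3] the equations force its inflow to be the inflow of [I] plus
    the outflow of [I1]. Commutativity yields the other half of associativity,
    and cancellativity of [M] that of composition: the outflow of [I2] at a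
    node of [I1] is determined by the inflows of [I1] and [I1 (+) I2]. *)
From mathcomp Require Import all_boot all_algebra.
From mathcomp Require Import boolp classical_sets.
Require Import Defs.

Set Implicit Arguments.
Unset Strict Implicit.
Unset Printing Implicit Defensive.

Import GRing.Theory.
Local Open Scope classical_set_scope.
Local Open Scope ring_scope.

Section FlowInterface.
Variables (M : flowDomain) (node : Type).
Implicit Types (I : flow_interface M node) (n : node).

(** Extending by 0 removes the membership proofs from the equations. The default is never read
    below: the guards and disjointness keep each node where the function is defined. *)
Definition total_inflow I n : M :=
  if pselect (dom I n) is left n_I then inflow n_I else 0.

Definition total_outflow I n : M :=
  if pselect ((~` dom I) n) is left nN_I then outflow nN_I else 0.

Lemma inflowE I n (n_I : dom I n) : inflow n_I = total_inflow I n.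
Proof.
rewrite /total_inflow; case: pselect => // n_I'.
by rewrite (Prop_irrelevance n_I n_I').
Qed.

Lemma outflowE I n (nN_I : (~` dom I) n) : outflow nN_I = total_outflow I n.
Proof.
rewrite /total_outflow; case: pselect => // nN_I'.
by rewrite (Prop_irrelevance nN_I nN_I').
Qed.

(** With the node fixed, the conditions on domains become propositional and fall to [tauto], and the
    rest are plain equations in [M]. *)
Lemma is_composition_pointwise I1 I2 I : is_composition I1 I2 I <->
  forall n, [/\ ~ (dom I1 n /\ dom I2 n),
    dom I n <-> dom I1 n \/ dom I2 n,
    dom I1 n -> total_inflow I1 n = total_inflow I n + total_outflow I2 n,
    dom I2 n -> total_inflow I2 n = total_inflow I n + total_outflow I1 n &
    ~ dom I n ->
      total_outflow I n = total_outflow I1 n + total_outflow I2 n].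
Proof.
split=> [[disj domE in1 in2 out] n|H].
  have disjP : ~ (dom I1 n /\ dom I2 n).
    by move=> n12; have : (dom I1 `&` dom I2) n by []; rewrite disj.
  have domP : dom I n <-> dom I1 n \/ dom I2 n by rewrite domE.
  split=> // [n1|n2|nN].
  - have n_I : dom I n by apply/domP; left.
    have nN2 : (~` dom I2) n by move=> n2; apply: disjP.
    by rewrite -(inflowE n1) -(inflowE n_I) -(outflowE nN2).
  - have n_I : dom I n by apply/domP; right.
    have nN1 : (~` dom I1) n by move=> n1; apply: disjP.
    by rewrite -(inflowE n2) -(inflowE n_I) -(outflowE nN1).
  - have nN1 : (~` dom I1) n by move=> n1; apply/nN/domP; left.
    have nN2 : (~` dom I2) n by move=> n2; apply/nN/domP; right.
    by rewrite -(outflowE nN1) -(outflowE nN2) -(@outflowE I n nN).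
split=> [||n n1 n_I nN2|n n2 n_I nN1|n nN nN1 nN2].
- by rewrite -subset0 => n n12; case: (H n).
- by apply/seteqP; split=> n; case: (H n) => _ [].
- by rewrite !inflowE outflowE; case: (H n) => _ _ ->.
- by rewrite !inflowE outflowE; case: (H n) => _ _ _ ->.
- by rewrite !outflowE; case: (H n) => _ _ _ _ ->.
Qed.

Lemma is_compositionC I1 I2 I :
  is_composition I1 I2 I -> is_composition I2 I1 I.
Proof.
move=> /is_composition_pointwise H; apply/is_composition_pointwise => n.
case: (H n) => disj domE in1 in2 out; split=> //; try tauto.
by move=> nN; rewrite addrC out.
Qed.

Lemma is_composition0 I : is_composition I (empty_interface M node) I.
Proof.
split=> [||n n_I n_I' nN0|n []|n nN nN' nN0] /=.
- by rewrite setI0.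
- by rewrite setU0.
- by rewrite !inflowE addr0.
- by rewrite !outflowE addr0.
Qed.

Lemma is_composition_assoc I1 I2 I3 I12 I :
    is_composition I1 I2 I12 -> is_composition I12 I3 I ->
  exists2 I23, is_composition I2 I3 I23 & is_composition I1 I23 I.
Proof.
move=> /is_composition_pointwise H12 /is_composition_pointwise H.
(* The inflow formula reads only genuine values: a node of [I2] or [I3] lies in [dom I] and outside
   [dom I1]. *)
pose I23 := @FlowInterface M node (dom I2 `|` dom I3)
  (fun n _ => total_inflow I n + total_outflow I1 n)
  (fun n _ => total_outflow I2 n + total_outflow I3 n).
have in23 n : dom I2 n \/ dom I3 n ->
    total_inflow I23 n = total_inflow I n + total_outflow I1 n.
  by move=> n23; rewrite -(@inflowE I23 n n23).
have out23 n : ~ (dom I2 n \/ dom I3 n) ->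
    total_outflow I23 n = total_outflow I2 n + total_outflow I3 n.
  by move=> nN23; rewrite -(@outflowE I23 n nN23).
exists I23; apply/is_composition_pointwise => n;
  case: (H12 n) (H n) => d12 dom12 in1 in2 out12 [d domE in12 in3 out].
- split=> [|//|n2|n3|].
  + tauto.
  (* On [I2], the inflow of [I12] expands to that of [I] plus the outflow of [I3]; on [I3], the
     outflow of [I12] splits into those of [I1] and [I2]. *)
  + rewrite in23; last by left.
    by rewrite in2 // in12 1?addrAC //; tauto.
  + rewrite in23; last by right.
    by rewrite in3 // out12 ?addrA //; tauto.
  + exact: out23.
(* True by conversion, but [tauto] needs it as a hypothesis. *)
- have dom23 : dom I23 n <-> dom I2 n \/ dom I3 n by [].
  split=> [||n1|/in23 //|nN].
  + tauto.
  + tauto.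
  + by rewrite out23 ?in1 ?in12 -?addrA 1?[_ I3 _ + _]addrC //; tauto.
  + by rewrite out // out12 ?out23 ?addrA //; tauto.
Qed.

Lemma is_composition_cancel I1 I2 I3 I :
  is_composition I1 I2 I -> is_composition I1 I3 I -> I2 = I3.
Proof.
move=> /is_composition_pointwise H2 /is_composition_pointwise H3.
apply: flow_interfaceP => [|n n2 n3|n nN2 nN3].
(* By disjointness, [dom I2] and [dom I3] are both [dom I] minus [dom I1]. *)
- by apply/seteqP; split=> n; case: (H2 n) (H3 n) => ? ? _ _ _ [? ? _ _ _];
    tauto.
- by rewrite !inflowE; case: (H2 n) (H3 n) => _ _ _ -> // _ [_ _ _ -> //].
- rewrite !outflowE.
  case: (H2 n) (H3 n) => _ domE in2 _ out2 [_ _ in3 _ out3].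
  (* In [dom I1] the inflow equation of [I1] is cancelled; otherwise the node is outside [dom I] and
     the outflow equation is. *)
  case: (pselect (dom I1 n)) => [n1|nN1].
  + by apply: (@fd_addI M (total_inflow I n)); rewrite -in2 // in3.
  + have nN : ~ dom I n by move=> /domE [].
    by apply: (@fd_addI M (total_outflow I1 n)); rewrite -out2 // out3.
Qed.

Lemma interface_compC I1 I2 : interface_comp I1 I2 = interface_comp I2 I1.
Proof.
case E: (interface_comp I2 I1) => [I|].
  by apply/interface_compP/is_compositionC/interface_compP.
case E': (interface_comp I1 I2) => [I|//].
by rewrite -E; apply/esym/interface_compP/is_compositionC/interface_compP.
Qed.

Lemma interface_compA_Some I1 I2 I3 I :
    obind (fun I12 => interface_comp I12 I3) (interface_comp I1 I2) = Some I ->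
  obind (fun I23 => interface_comp I1 I23) (interface_comp I2 I3) = Some I.
Proof.
case E: (interface_comp I1 I2) => [I12|//] /= /interface_compP c.
have [I23 /interface_compP -> c1] :=
  is_composition_assoc ((interface_compP _ _ _).1 E) c.
exact/interface_compP.
Qed.

Lemma interface_compA I1 I2 I3 :
  obind (fun I12 => interface_comp I12 I3) (interface_comp I1 I2) =
  obind (fun I23 => interface_comp I1 I23) (interface_comp I2 I3).
Proof.
(* Reversing the three operands exchanges the bracketings, so the converse half is the proved half
   applied to [I3], [I2], [I1]. *)
have flip J1 J2 J3 :
    obind (fun I12 => interface_comp I12 J3) (interface_comp J1 J2) =
    obind (fun I23 => interface_comp J3 I23) (interface_comp J2 J1).
  by rewrite interface_compC; case: interface_comp => //= I12;
    exact: interface_compC.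
case E: (obind _ (interface_comp I1 I2)) => [I|].
  by rewrite (interface_compA_Some E).
case E': obind => [I|//]; move: E'; rewrite -flip => /interface_compA_Some.
by rewrite -flip E.
Qed.

End FlowInterface.

Theorem theorem1 (M : flowDomain) (node : Type) :
  separation_algebra (@interface_comp M node) (empty_interface M node).
Proof.
split=> [||I|I1 I2 I3].
- exact: interface_compA.
- exact: interface_compC.
- have I0 : interface_comp I (empty_interface M node) = Some I.
    exact/interface_compP/is_composition0.
  by split; last rewrite interface_compC.
- case E: (interface_comp I1 I2) => [I|//] _ /esym /interface_compP c3.
  by apply: is_composition_cancel c3; apply/interface_compP.
Qed.
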